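(* Let $P$ be a partial algorithm from natural numbers to $\{0,1\}$ that is not extendable to a totally defined algorithm, and for each natural number $n$ let $a_n^1$ and $a_n^2$ be the constructive real numbers built from $P$ as in the context. Let $p$ and $q$ be rational numbers such that $p<q$. Then it is undecidable whether $M_p(a_n^1,a_n^2)=M_q(a_n^1,a_n^2)$ or $M_p(a_n^1,a_n^2)<M_q(a_n^1,a_n^2)$; that is, there is no algorithm which, for every natural number $n$, terminates and correctly decides which of these two relations holds.
   Context: ''Algorithm'' means a (partial) computable function on natural numbers given by a program; ''totally defined'' means that it terminates on every input. $P$ is a partially defined algorithm taking values in $\{0,1\}$ such that no total computable function $\mathbb{N}\to\{0,1\}$ agrees with $P$ on the whole domain of $P$. A program computing $P$ is fixed, so that one can check effectively whether $P$ has finished working on input $n$ by step $k$; if $P$ terminates on $n$, it finishes at a definite step. A constructive real number (CRN) is a pair of algorithms $(A,B)$, where $A$ transforms natural numbers into rational numbers and $B$ transforms natural numbers into natural numbers, such that for every integer $n>0$ and all $i,j\ge B(n)$ one has $|A(i)-A(j)|<2^{-n}$. If the CRN is denoted $x$, then $x(k)$ denotes $A(k)$; its value is the real number $\lim_k x(k)$, and equalities and inequalities between CRNs, and between expressions in them, refer to these values. Power mean: for positive reals $x_1,\dots,x_r$ and real $p\neq 0$, $M_p(x_1,\dots,x_r)=\left(\frac{x_1^p+\cdots+x_r^p}{r}\right)^{1/p}$, and $M_0(x_1,\dots,x_r)=\sqrt[r]{x_1\cdots x_r}$ (the geometric mean). Construction: for each natural $n$, $a_n^1$ is the CRN whose sequence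 of rationals is $a_n^1(k)=3+2^{-k}$ if $P$ has not yet finished working on input $n$ by step $k$, and $a_n^1(k)=3+2^{-m}$ if $P$ has finished working on $n$ by step $k$, where $m$ is the step number at which $P$ finished working. (This sequence converges in itself at geometric speed, so it gives a CRN.) The CRN $a_n^2$ is the constant sequence $3$ for every $n$. *)

(* Defs.v *)
From HB Require Import structures.
From mathcomp Require Import all_boot all_order all_algebra.
From mathcomp Require Import all_classical all_reals all_analysis.
From mathcomp Require Import lra zify.
Import Order.TTheory GRing.Theory Num.Theory.
Import numFieldNormedType.Exports.

Set Implicit Arguments.
Unset Strict Implicit.
Unset Printing Implicit Defensive.

Local Open Scope nat_scope.

(* Programs for the partial recursive functions.  Arities are not tracked: a
   program acts on any list of naturals, missing arguments being read as 0. *)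
Inductive prog : Type :=
| Zero
| Succ
| Proj of nat
| Comp of prog & seq prog
| Prec of prog & prog   (* recursion on the head argument *)
| Mu of prog.           (* search for the least head argument giving 0 *)

(* Computations are clocked: [k] is the number of steps still allowed, and a
   terminating computation returns its result with the steps left over.  [None]
   means that the computation has not finished within the allowed steps. *)

Definition run_args (ev : prog -> nat -> option (nat * nat)) :=
  fix args (gs : seq prog) (k : nat) : option (seq nat * nat) :=
    if gs is g :: gs' then
      if ev g k is Some (y, k1) then
        if args gs' k1 is Some (ys, k2) then Some (y :: ys, k2) else None
      else None
    else Some ([::], k).

Definition run_prec (evf : nat -> option (nat * nat))
    (evg : nat -> nat -> nat -> option (nat * nat)) :=
  fix loop (n k : nat) : option (nat * nat) :=
    if n is n'.+1 then
      if loop n' k is Some (r, k1) then evg n' r k1 else None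
    else evf k.

(* [s] only bounds the number of iterations, for structural recursion; each
   iteration consumes at least one step, so [s = k] is never the limiting
   factor. *)
Definition run_mu (ev : nat -> nat -> option (nat * nat)) :=
  fix search (s y k : nat) : option (nat * nat) :=
    if s is s'.+1 then
      if ev y k is Some (r, k1) then
        if r == 0 then Some (y, k1) else search s' y.+1 k1
      else None
    else None.

(* Entering any program node, basic or compound, costs one step. *)
Fixpoint run (c : prog) (v : seq nat) (k : nat) {struct c} :
    option (nat * nat) :=
  if k is k'.+1 then
    match c with
    | Zero => Some (0, k')
    | Succ => Some ((head 0 v).+1, k')
    | Proj i => Some (nth 0 v i, k')
    | Comp f gs =>
        if run_args (fun g => run g v) gs k' is Some (ys, k1)
        then run f ys k1 else None
    | Prec f g =>
        run_prec (run f (behead v)) (fun n r => run g [:: n, r & behead v])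
          (head 0 v) k'
    | Mu f => run_mu (fun y => run f (y :: v)) k' 0 k'
    end
  else None.

Definition returns (c : prog) (n y : nat) : Prop :=
  exists k r, run c [:: n] k = Some (y, r).

Definition finished (c : prog) (n k : nat) : bool := isSome (run c [:: n] k).

(* The least number of steps within which [P] finishes on [n], provided that
   it finishes within [k] steps. *)
Definition finish_step (P : prog) (n k : nat) : nat :=
  find (finished P n) (iota 0 k.+1).

Definition computable (f : nat -> nat) : Prop :=
  exists c : prog, forall n, returns c n (f n).

Definition computable_rat (a : nat -> rat) : Prop :=
  exists f g h : nat -> nat,
    [/\ computable f, computable g, computable h &
      forall k, a k = (((f k)%:R - (g k)%:R) / ((h k).+1)%:R)%R].

Definition zero_one_valued (P : prog) : Prop :=
  forall n y, returns P n y -> y = 0 \/ y = 1.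

Definition extendable (P : prog) : Prop :=
  exists T : nat -> nat,
    [/\ computable T, forall n, T n = 0 \/ T n = 1 &
      forall n y, returns P n y -> T n = y].

Lemma run_args_add (ev : prog -> nat -> option (nat * nat)) gs :
  (forall g, List.In g gs -> forall k y r d,
     ev g k = Some (y, r) -> ev g (k + d) = Some (y, r + d)) ->
  forall k ys r d, run_args ev gs k = Some (ys, r) ->
    run_args ev gs (k + d) = Some (ys, r + d).
Proof.
elim: gs => [|g gs IH] Hev k ys r d /=; first by case=> <- <-.
case E: (ev g k) => [[y k1]|] //.
case E2: (run_args ev gs k1) => [[zs k2]|] // [<- <-].
have -> := Hev g (or_introl erefl) _ _ _ d E.
by have -> := IH (fun g' H => Hev g' (or_intror H)) _ _ _ d E2.
Qed.

Lemma run_prec_add evf evg :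
  (forall k y r d, evf k = Some (y, r) -> evf (k + d) = Some (y, r + d)) ->
  (forall a b k y r d, evg a b k = Some (y, r) ->
     evg a b (k + d) = Some (y, r + d)) ->
  forall n k y r d, run_prec evf evg n k = Some (y, r) ->
    run_prec evf evg n (k + d) = Some (y, r + d).
Proof.
move=> Hf Hg; elim=> [|n IH] k y r d /=; first exact: Hf.
case E: (run_prec evf evg n k) => [[z k1]|] // /Hg Eg.
by rewrite (IH _ _ _ d E).
Qed.

Lemma run_mu_add ev :
  (forall a k y r d, ev a k = Some (y, r) -> ev a (k + d) = Some (y, r + d)) ->
  forall s n k y r d, run_mu ev s n k = Some (y, r) ->
    run_mu ev (s + d) n (k + d) = Some (y, r + d).
Proof.
move=> Hev; elim=> [|s IH] n k y r d //=.
case E: (ev n k) => [[z k1]|] //; rewrite (Hev _ _ _ _ d E).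
by case: (z == 0) => [[<- <-]|/IH].
Qed.

Lemma run_add c v k y r d :
  run c v k = Some (y, r) -> run c v (k + d) = Some (y, r + d).
Proof.
move: c v k y r d; fix IH 1 => -[||i|f gs|f g|f] v [|k] y r d //=.
- by case=> <- <-.
- by case=> <- <-.
- by case=> <- <-.
- have Hgs : forall g, List.In g gs -> forall k y r d,
      run g v k = Some (y, r) -> run g v (k + d) = Some (y, r + d).
    elim: gs => [|g gs IHgs] //= g' [<-|/IHgs //] k0 y0 r0 d0.
    exact: IH.
  case E: (run_args _ gs k) => [[ys k1]|] //.
  rewrite (run_args_add Hgs d E); exact: IH.
- apply: run_prec_add => *; exact: IH.
- apply: run_mu_add => *; exact: IH.
Qed.

Lemma finished_mono c n k k' : k <= k' -> finished c n k -> finished c n k'.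
Proof.
move=> /subnKC <-; rewrite /finished.
by case E: (run c _ k) => [[y r]|] // _; rewrite (run_add _ E).
Qed.

Definition computes (c : prog) (F : seq nat -> nat) : Prop :=
  forall v, exists k r, run c v k = Some (F v, r).

Lemma computes_comp1 f F g G :
  computes f F -> computes g G -> computes (Comp f [:: g]) (fun v => F [:: G v]).
Proof.
move=> Hf Hg v; have [k1 [r1 E1]] := Hg v; have [k2 [r2 E2]] := Hf [:: G v].
exists (k1 + k2).+1, (r2 + r1) => /=.
by rewrite (run_add _ E1) addnC (run_add _ E2).
Qed.

Lemma computes_comp2 f F g G h H :
  computes f F -> computes g G -> computes h H ->
  computes (Comp f [:: g; h]) (fun v => F [:: G v; H v]).
Proof.
move=> Hf Hg Hh v; have [k1 [r1 E1]] := Hg v; have [k2 [r2 E2]] := Hh v.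
have [k3 [r3 E3]] := Hf [:: G v; H v].
exists (k1 + (k2 + k3)).+1, (r3 + (r2 + r1)) => /=.
rewrite (run_add _ E1) [r1 + _]addnC -addnA (run_add _ E2).
by rewrite addnCA (run_add _ E3).
Qed.

Fixpoint prec_fun (F G : seq nat -> nat) (v : seq nat) (n : nat) : nat :=
  if n is n'.+1 then G [:: n', prec_fun F G v n' & v] else F v.

Lemma computes_prec f F g G : computes f F -> computes g G ->
  computes (Prec f g) (fun v => prec_fun F G (behead v) (head 0 v)).
Proof.
move=> Hf Hg v /=; move: (behead v) (head 0 v) => w n.
suff [k [r E]] : exists k r,
    run_prec (run f w) (fun n r => run g [:: n, r & w]) n k
    = Some (prec_fun F G w n, r).
  by exists k.+1, r.
elim: n => [|n [k1 [r1 E1]]] /=; first exact: Hf.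
have [k2 [r2 E2]] := Hg [:: n, prec_fun F G w n & w].
exists (k1 + k2), (r2 + r1).
rewrite (run_prec_add _ _ k2 E1); first by rewrite addnC (run_add _ E2).
- by move=> *; apply: run_add.
- by move=> *; apply: run_add.
Qed.

Lemma computes_proj i : computes (Proj i) (fun v => nth 0 v i).
Proof. by move=> v; exists 1, 0. Qed.

Lemma computes_succ : computes Succ (fun v => (head 0 v).+1).
Proof. by move=> v; exists 1, 0. Qed.

Lemma computes_zero : computes Zero (fun=> 0).
Proof. by move=> v; exists 1, 0. Qed.

Lemma computes_computable c F f :
  computes c F -> (forall n, F [:: n] = f n) -> computable f.
Proof. by move=> Hc HF; exists c => n; rewrite /returns -HF; apply: Hc. Qed.

Lemma computable_ext f g : f =1 g -> computable f -> computable g.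
Proof. by move=> fg [c Hc]; exists c => n; rewrite -fg. Qed.

Lemma computable_id : computable id.
Proof. exact: (computes_computable (computes_proj 0)). Qed.

Lemma computes_const m : exists c, computes c (fun=> m).
Proof.
elim: m => [|m [c Hc]]; first by exists Zero; apply: computes_zero.
by exists (Comp Succ [:: c]); apply: (computes_comp1 computes_succ Hc).
Qed.

Lemma computable_const m : computable (fun=> m).
Proof. by have [c Hc] := computes_const m; apply: (computes_computable Hc). Qed.

Lemma computable_cons a f : computable f ->
  computable (fun n => if n is n'.+1 then f n' else a).
Proof.
move=> [c Hc]; have [d Hd] := computes_const a.
have step n z : exists k r, run (Comp c [:: Proj 0]) [:: n; z] k = Some (f n, r).
  by have [k [r E]] := Hc n; exists k.+2, r.
exists (Prec d (Comp c [:: Proj 0])) => n.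
suff [k [r E]] : exists k r,
    run_prec (run d [::]) (fun n z => run (Comp c [:: Proj 0]) [:: n; z]) n k
    = Some (if n is n'.+1 then f n' else a, r).
  by exists k.+1, r.
elim: n => [|n [k1 [r1 E1]]]; first exact: Hd.
have [k2 [r2 E2]] := step n (if n is n'.+1 then f n' else a).
exists (k1 + k2), (r2 + r1); rewrite [LHS]/run_prec -/(run_prec _ _).
rewrite (run_prec_add _ _ k2 E1); first by rewrite addnC (run_add _ E2).
- by move=> *; apply: run_add.
- by move=> *; apply: run_add.
Qed.

Lemma computable_eventually_const f m y :
  (forall n, m <= n -> f n = y) -> computable f.
Proof.
elim: m f => [|m IH] f Hf.
  by apply: computable_ext (computable_const y) => n; rewrite Hf.
have Hs : computable (fun n => f n.+1) by apply: IH => n mn; apply: Hf.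
by apply: computable_ext (computable_cons (f 0) Hs) => -[].
Qed.

Definition addp := Prec (Proj 0) (Comp Succ [:: Proj 1]).

Lemma computes_add : exists F, computes addp F /\ forall a b, F [:: a; b] = a + b.
Proof.
eexists; split.
  apply: computes_prec; first exact: computes_proj.
  exact: (computes_comp1 computes_succ (computes_proj 1)).
by move=> a b /=; elim: a => //= a ->.
Qed.

(* [2 ^ k - 1] *)
Lemma computes_pow2 : exists c F, computes c F /\ forall n, F [:: n] = (2 ^ n).-1.
Proof.
have [A [HA EA]] := computes_add.
eexists _, _; split.
  apply: computes_prec; first exact: computes_zero.
  apply: (computes_comp1 computes_succ).
  exact: (computes_comp2 HA (computes_proj 1) (computes_proj 1)).
elim=> //= n ->; rewrite EA expnS; have : 0 < 2 ^ n by rewrite expn_gt0.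
by lia.
Qed.

Lemma computable_den : computable (fun k => (2 ^ k).-1).
Proof. by have [c [F [H E]]] := computes_pow2; apply: computes_computable H E. Qed.

Lemma computable_num : computable (fun k => (3 * 2 ^ k).+1).
Proof.
have [c [F [Hc Ec]]] := computes_pow2; have [A [HA EA]] := computes_add.
have [d Hd] := computes_const 4.
have H := computes_comp2 HA Hc (computes_comp2 HA Hc (computes_comp2 HA Hc Hd)).
apply: computes_computable H _ => n; rewrite !EA Ec.
have : 0 < 2 ^ n by rewrite expn_gt0.
by lia.
Qed.

Local Open Scope ring_scope.

(* Constructive real numbers.  Only the input-output behaviour of the two
   algorithms is recorded, together with the fact that it is computable. *)
Record crn : Type := CRN {
  crn_approx :> nat -> rat;
  crn_modulus : nat -> nat;
  crn_approx_computable : computable_rat crn_approx;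
  crn_modulus_computable : computable crn_modulus;
  crn_cauchy : forall n i j : nat, (0 < n)%N ->
    (crn_modulus n <= i)%N -> (crn_modulus n <= j)%N ->
    `|crn_approx i - crn_approx j| < 2^-1 ^+ n
}.

Definition crn_value (R : realType) (x : crn) : R :=
  limn (fun k => ratr (x k) : R).

Definition a1_approx (P : prog) (n k : nat) : rat :=
  3 + 2^-1 ^+ (if finished P n k then finish_step P n k else k).

Lemma finish_step_const P n k k' : (k <= k')%N -> finished P n k ->
  finish_step P n k' = finish_step P n k.
Proof.
move=> kk' Fk; rewrite /finish_step -(subnKC kk') -addSn iotaD find_cat.
suff -> : has (finished P n) (iota 0%N k.+1) by [].
by apply/hasP; exists k => //; rewrite mem_iota add0n ltnSn.
Qed.

Lemma finish_step_gt P n i j : ~~ finished P n i -> finished P n j ->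
  (i < finish_step P n j)%N.
Proof.
move=> NFi Fj; rewrite ltnNge; apply: contra NFi => le_i.
have hasF : has (finished P n) (iota 0%N j.+1).
  by apply/hasP; exists j => //; rewrite mem_iota add0n ltnSn.
have := nth_find 0%N hasF; rewrite nth_iota.
  by rewrite add0n; apply: finished_mono.
by move: hasF; rewrite has_find size_iota.
Qed.

Lemma approx_fraction (e : nat) : 3 + 2^-1 ^+ e =
  ((3 * 2 ^ e).+1%N%:R - 0%N%:R) / (2 ^ e).-1.+1%N%:R :> rat.
Proof.
have e0 : 2 ^+ e != 0 :> rat by rewrite expf_neq0.
rewrite prednK ?expn_gt0// subr0 -(natr1 (3 * 2 ^ e)%N) natrM natrX.
by rewrite mulrDl mulfK// div1r exprVn.
Qed.

(* For fixed [n] the sequence is computable by cases on whether [P] ever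
   finishes on [n]: if it does, the sequence is eventually constant. *)
Lemma computable_stop P n (f : nat -> nat) : computable f ->
  computable (fun k => f (if finished P n k then finish_step P n k else k)).
Proof.
move=> Hf; have [[m Fm]|NF] := pselect (exists m, finished P n m).
  apply: (@computable_eventually_const _ m (f (finish_step P n m))) => k mk.
  by rewrite (finished_mono mk Fm) (finish_step_const mk Fm).
apply: computable_ext Hf => k; case: ifP => // Fk.
by exfalso; apply: NF; exists k.
Qed.

Lemma a1_computable P n : computable_rat (a1_approx P n).
Proof.
pose e k := if finished P n k then finish_step P n k else k.
exists (fun k => (3 * 2 ^ e k).+1%N), (fun=> 0%N), (fun k => (2 ^ e k).-1%N).
split=> [||| k]; last exact: approx_fraction.
- exact: (computable_stop P n computable_num).
- exact: computable_const.
- exact: (computable_stop P n computable_den).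
Qed.

Lemma dist_half_lt (n i j : nat) : (n <= i)%N -> (n <= j)%N ->
  `|2^-1 ^+ i - 2^-1 ^+ j| < 2^-1 ^+ n :> rat.
Proof.
have pos e : 0 < 2^-1 ^+ e :> rat by rewrite exprn_gt0.
have le e : (n <= e)%N -> 2^-1 ^+ e <= 2^-1 ^+ n :> rat.
  by move=> ne; rewrite ler_wiXn2l.
move=> /le li /le lj; rewrite ltr_norml.
have := pos i; have := pos j; lra.
Qed.

Lemma a1_cauchy P n (l i j : nat) : (0 < l)%N -> (l <= i)%N -> (l <= j)%N ->
  `|a1_approx P n i - a1_approx P n j| < 2^-1 ^+ l.
Proof.
move=> _; wlog ij : i j / (i <= j)%N => [W li lj|li lj].
  by case/orP: (leq_total i j) => ?; [|rewrite distrC]; apply: W.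
rewrite /a1_approx opprD addrACA subrr add0r; case: (boolP (finished P n i)) => Fi.
  rewrite (finished_mono ij Fi) (finish_step_const ij Fi) subrr normr0.
  by rewrite exprn_gt0.
apply: dist_half_lt => //; case: ifP => // Fj.
exact: leq_trans li (ltnW (finish_step_gt Fi Fj)).
Qed.

Definition a1 (P : prog) (n : nat) : crn :=
  CRN (a1_computable P n) computable_id (@a1_cauchy P n).

Lemma three_computable : computable_rat (fun=> 3).
Proof.
exists (fun=> 3%N), (fun=> 0%N), (fun=> 0%N); split; try exact: computable_const.
by move=> _; rewrite subr0 divr1.
Qed.

Lemma three_cauchy (n i j : nat) : (0 < n)%N -> (0 <= i)%N -> (0 <= j)%N ->
  `|3 - 3| < 2^-1 ^+ n :> rat.
Proof. by rewrite subrr normr0 exprn_gt0. Qed.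

Definition a2 (n : nat) : crn :=
  CRN three_computable (computable_const 0) three_cauchy.

Definition power_mean (R : realType) (p : R) (s : seq R) : R :=
  if p == 0 then (\prod_(x <- s) x) `^ ((size s)%:R^-1)
  else ((\sum_(x <- s) x `^ p) / (size s)%:R) `^ p^-1.

(* [M_p (a_n^1, a_n^2)] *)
Definition mean_a (R : realType) (P : prog) (p : rat) (n : nat) : R :=
  power_mean (ratr p) [:: crn_value R (a1 P n); crn_value R (a2 n)].

(* Main.v *)
Require Import Defs.
From mathcomp Require Import all_boot all_order all_algebra.
From mathcomp Require Import all_classical all_reals all_analysis.
From mathcomp Require Import ring lra.
Import Order.TTheory GRing.Theory Num.Theory.
Import numFieldNormedType.Exports.
Local Open Scope ring_scope.

(* If [P] never finishes on [n] then both reals are 3 and all their power means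
   agree; if it finishes, they are distinct and the power mean is strictly
   increasing in the exponent: for 0 <= p < q by strict convexity of powers, and
   for p < q <= 0 by the duality M_{-p} M_p = x y.  So an algorithm telling the
   two relations apart decides the halting of [P], and then answering 0 off the
   domain of [P] extends [P] to a total algorithm. *)

(** With [z = expR s], division by [z] turns the claim into [r < expR ((r - 1) * s) + (r - 1) * expR
    (- s)], which follows from [1 + t < expR t] at [t = (r - 1) * s] and at [t = - s]. *)
Lemma bernoulli_powR_lt (R : realType) (z r : R) :
  0 < z -> z != 1 -> 1 < r -> 1 + r * (z - 1) < z `^ r.
Proof.
move=> z0 z1 r1; pose s := ln z.
have zE : z = expR s by rewrite lnK.
have s0 : s != 0 by rewrite ln_eq0.
have zrE : z `^ r = expR ((r - 1) * s) * z.
  by rewrite /powR gt_eqF// -/s [in RHS]zE -expRD; congr expR; ring.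
have zN : expR (- s) * z = 1 by rewrite zE -expRD addNr expR0.
have h1 : 1 + (r - 1) * s < expR ((r - 1) * s).
  by apply: expR_gt1Dx; rewrite mulf_neq0// subr_eq0 gt_eqF.
have h2 : 1 + - s < expR (- s) by apply: expR_gt1Dx; rewrite oppr_eq0.
have h3 : r < expR ((r - 1) * s) + (r - 1) * expR (- s).
  have : (r - 1) * (1 + - s) < (r - 1) * expR (- s).
    by rewrite ltr_pM2l// subr_gt0.
  lra.
have := h3; rewrite -(ltr_pM2r z0) mulrDl -zrE -mulrA zN.
lra.
Qed.

(** Scale by the midpoint [m] and add the Bernoulli bounds at [a / m] and [b / m]; the linear terms
    cancel because [a / m + b / m = 2]. *)
Lemma powR_midpoint_lt (R : realType) (a b r : R) :
  0 < a -> 0 < b -> a != b -> 1 < r ->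
  ((a + b) / 2) `^ r < (a `^ r + b `^ r) / 2.
Proof.
move=> a0 b0 ab r1; set m := (a + b) / 2.
have m0 : 0 < m by rewrite /m; lra.
have mr0 : 0 < m `^ r by apply: powR_gt0.
have scaled c : 0 < c -> c != m -> m `^ r * (1 + r * (c / m - 1)) < c `^ r.
  move=> c0 cm; have -> : c `^ r = m `^ r * (c / m) `^ r.
    rewrite -powRM//; [|exact: ltW|by rewrite divr_ge0// ltW].
    by rewrite mulrC divfK// gt_eqF.
  rewrite ltr_pM2l//; apply: bernoulli_powR_lt => //; first exact: divr_gt0.
  rewrite -subr_eq0 -(divff (lt0r_neq0 m0)) -mulrBl.
  by rewrite mulf_neq0 ?subr_eq0// invr_eq0 gt_eqF.
have am : a != m by apply: contra ab => /eqP; rewrite /m => ?; apply/eqP; lra.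
have bm : b != m by apply: contra ab => /eqP; rewrite /m => ?; apply/eqP; lra.
have hs : a / m + b / m = 2.
  by rewrite -mulrDl (_ : a + b = 2 * m) ?mulfK ?gt_eqF// /m; lra.
have := ltrD (scaled a a0 am) (scaled b b0 bm).
rewrite -mulrDr (_ : _ + _ + _ = 2 :> R); last first.
  rewrite (_ : 1 + _ + _ = 2 + r * (a / m + b / m - 2)); last by ring.
  by rewrite hs subrr mulr0 addr0.
by move=> ?; lra.
Qed.

(** * Power means of two positive reals *)

Section PowerMean.
Context {R : realType}.
Implicit Types p q x y : R.

Lemma power_mean0 x y : power_mean 0 [:: x; y] = (x * y) `^ 2^-1.
Proof. by rewrite /power_mean eqxx !big_cons big_nil mulr1. Qed.

Lemma power_meanE p x y : p != 0 ->
  power_mean p [:: x; y] = ((x `^ p + y `^ p) / 2) `^ p^-1.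
Proof. by move=> /negPf p0; rewrite /power_mean p0 !big_cons big_nil addr0. Qed.

Lemma power_mean_gt0 p x y : 0 < x -> 0 < y -> 0 < power_mean p [:: x; y].
Proof.
move=> x0 y0; have [->|p0] := eqVneq p 0.
  by rewrite power_mean0 powR_gt0// mulr_gt0.
by rewrite power_meanE// powR_gt0// divr_gt0// addr_gt0// powR_gt0.
Qed.

Lemma power_mean_const p x : 0 < x -> power_mean p [:: x; x] = x.
Proof.
move=> x0; have [->|p0] := eqVneq p 0.
  by rewrite power_mean0 powR12_sqrt ?mulr_ge0 ?ltW// -expr2 sqrtr_sqr gtr0_norm.
rewrite power_meanE// (_ : _ / 2 = x `^ p); last by lra.
by rewrite -powRrM divff// powRr1// ltW.
Qed.

Lemma power_meanN p {x y} : 0 < x -> 0 < y ->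
  power_mean (- p) [:: x; y] * power_mean p [:: x; y] = x * y.
Proof.
move=> x0 y0; have xy0 : 0 < x * y by rewrite mulr_gt0.
have [->|p0] := eqVneq p 0.
  rewrite oppr0 power_mean0 powR12_sqrt ?ltW//.
  by rewrite -expr2 sqr_sqrtr// ltW.
rewrite !power_meanE ?oppr_eq0// invrN !powRN.
have a0 : 0 < x `^ p by apply: powR_gt0.
have b0 : 0 < y `^ p by apply: powR_gt0.
have -> : ((x `^ p)^-1 + (y `^ p)^-1) / 2
    = ((x `^ p + y `^ p) / 2) * (x * y) `^ (- p).
  rewrite powRN powRM ?ltW//; field.
  by rewrite !gt_eqF.
have s0 : 0 < (x `^ p + y `^ p) / 2 by rewrite divr_gt0// addr_gt0.
rewrite powRM ?powR_ge0 ?ltW// -powRrM mulNr divff// powR_inv1 ?ltW//.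
by rewrite invfM invrK mulrAC mulVf ?mul1r// gt_eqF// powR_gt0.
Qed.

Lemma power_mean_lt_ge0 p q x y : 0 < x -> 0 < y -> x != y ->
  0 <= p -> p < q -> power_mean p [:: x; y] < power_mean q [:: x; y].
Proof.
move=> x0 y0 xy; rewrite le_eqVlt => /predU1P[<- q0|p0 pq].
  (* Case [p = 0]: both sides become powers with exponent [q^-1], leaving AM-GM for [x]^ q[and]y
     [^ q], strict since the square of [x]^ (q / 2) - y [^ (q / 2)] is positive. *)
  rewrite power_mean0 power_meanE ?gt_eqF//.
  have -> : (x * y) `^ 2^-1 = ((x * y) `^ (q / 2)) `^ q^-1.
    by rewrite -powRrM mulrAC divff ?mul1r// gt_eqF.
  apply: gt0_ltr_powR; rewrite ?invr_gt0// ?nnegrE ?powR_ge0//.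
    by rewrite divr_ge0// addr_ge0// powR_ge0.
  have sq z : z `^ q = z `^ (q / 2) ^+ 2.
    by rewrite -powR_mulrn ?powR_ge0// -powRrM divfK.
  rewrite powRM ?ltW// !sq.
  have /negPf : x `^ (q / 2) != y `^ (q / 2).
    apply: contra xy => /eqP/powR_injective E.
    by rewrite E// ?nnegrE ?ltW// divr_gt0.
  move: (x `^ (q / 2)) (y `^ (q / 2)) => u v uv.
  have : 0 < (u - v) ^+ 2 by rewrite exprn_even_gt0// subr_eq0 uv.
  by rewrite sqrrB; lra.
(* Case [0 < p]: the midpoint inequality with exponent [q / p > 1] at the points [x]^ p[and]y
   [^ p]. *)
have q0 : 0 < q := lt_trans p0 pq.
rewrite !power_meanE ?gt_eqF//.
set s := (x `^ p + y `^ p) / 2.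
have s0 : 0 < s by rewrite divr_gt0// addr_gt0// powR_gt0.
have -> : s `^ p^-1 = (s `^ (q / p)) `^ q^-1.
  by rewrite -powRrM mulrAC divff ?mul1r// gt_eqF.
apply: gt0_ltr_powR; rewrite ?invr_gt0// ?nnegrE ?powR_ge0//.
  by rewrite divr_ge0// addr_ge0// powR_ge0.
have powq z : z `^ q = (z `^ p) `^ (q / p).
  by rewrite -powRrM mulrC divfK// gt_eqF.
rewrite !powq; apply: powR_midpoint_lt; rewrite ?powR_gt0//.
  apply: contra xy => /eqP/powR_injective E.
  by rewrite E// ?nnegrE ltW.
by rewrite ltr_pdivlMr// mul1r.
Qed.

Lemma power_mean_lt_le0 p q x y : 0 < x -> 0 < y -> x != y ->
  q <= 0 -> p < q -> power_mean p [:: x; y] < power_mean q [:: x; y].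
Proof.
move=> x0 y0 xy q0 pq.
have dual r : power_mean r [:: x; y] = x * y / power_mean (- r) [:: x; y].
  by rewrite -(power_meanN r x0 y0) mulrAC divff ?mul1r// gt_eqF// power_mean_gt0.
rewrite (dual p) (dual q) ltr_pM2l ?mulr_gt0//.
rewrite ltf_pV2 ?posrE ?power_mean_gt0//.
by apply: power_mean_lt_ge0; rewrite ?oppr_ge0 ?ltrN2.
Qed.

Lemma power_mean_lt p q x y : 0 < x -> 0 < y -> x != y ->
  p < q -> power_mean p [:: x; y] < power_mean q [:: x; y].
Proof.
move=> x0 y0 xy pq; have [p0|p0] := leP 0 p; first exact: power_mean_lt_ge0.
have [q0|q0] := leP q 0; first exact: power_mean_lt_le0.
(* For [p < 0 < q] the geometric mean lies strictly between. *)
by apply: (@lt_trans _ _ (power_mean 0 [:: x; y]));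
  [apply: power_mean_lt_le0|apply: power_mean_lt_ge0].
Qed.

End PowerMean.


(** * Values of the constructive reals and of their means *)

Lemma crn_value_a2 (R : realType) n : crn_value R (a2 n) = 3.
Proof. by rewrite /crn_value /= ratr_nat; apply: lim_cst. Qed.

Lemma crn_value_a1_finished (R : realType) {P n m} : finished P n m ->
  crn_value R (a1 P n) = 3 + 2^-1 ^+ finish_step P n m.
Proof.
move=> Fm; apply: lim_near_cst => //; near=> k.
have mk : (m <= k)%N by near: k; exact: nbhs_infty_ge.
rewrite /= /a1_approx (finished_mono mk Fm) (finish_step_const mk Fm).
by rewrite rmorphD rmorphXn fmorphV /= !ratr_nat.
Unshelve. all: by end_near. Qed.

Lemma crn_value_a1_unfinished (R : realType) P n :
  (forall k, ~~ finished P n k) -> crn_value R (a1 P n) = 3.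
Proof.
move=> NF; rewrite /crn_value.
have -> : (fun k => ratr (a1 P n k) : R) = (fun k => 3 + 2^-1 ^+ k).
  apply/funext => k /=; rewrite /a1_approx (negPf (NF k)).
  by rewrite rmorphD rmorphXn fmorphV /= !ratr_nat.
rewrite -[RHS]addr0; apply: cvg_lim => //.
apply: cvgD; first exact: cvg_cst.
by apply: cvg_expr; rewrite ger0_norm ?invf_lt1 ?ltr1n ?invr_ge0.
Qed.

Lemma mean_a_unfinished (R : realType) P (p : rat) n :
  (forall k, ~~ finished P n k) -> mean_a R P p n = 3.
Proof.
move=> NF; rewrite /mean_a crn_value_a2 crn_value_a1_unfinished//.
exact: power_mean_const.
Qed.

(** After halting, the two values differ by a positive power of 1/2, so strict monotonicity in the
    exponent applies. *)
Lemma mean_a_finished_lt (R : realType) {P} {p q : rat} {n m} : finished P n m ->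
  p < q -> mean_a R P p n < mean_a R P q n.
Proof.
move=> Fm pq; rewrite /mean_a crn_value_a2 (crn_value_a1_finished R Fm).
have e0 : 0 < 2^-1 ^+ finish_step P n m :> R by rewrite exprn_gt0// invr_gt0.
apply: power_mean_lt; rewrite ?ltr_rat ?addr_gt0//.
by rewrite -subr_eq0 addrAC subrr add0r gt_eqF.
Qed.

Lemma returns_inj {c n y z} : returns c n y -> returns c n z -> y = z.
Proof.
move=> [k [r E]] [l [s F]].
(* Both runs are compared at the common budget [k + l]. *)
by have := run_add l E; rewrite addnC (run_add k F) => -[].
Qed.

Lemma returns_finished {c n y} : returns c n y -> exists k, finished c n k.
Proof. by move=> [k [r E]]; exists k; rewrite /finished E. Qed.

Lemma finished_returns {c n k} : finished c n k -> exists y, returns c n y.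
Proof.
rewrite /finished; case E: (run c _ k) => [[y r]|] // _.
by exists y, k, r.
Qed.

(* Primitive recursion on the answer of [D] serves as a conditional: the step,
   and with it [P], is not entered when the answer is 0. *)
Definition guard (D P : prog) : prog :=
  Comp (Prec Zero (Comp P [:: Proj 2])) [:: D; Proj 0].

Lemma guard_returns0 {D P n} : returns D n 0%N -> returns (guard D P) n 0%N.
Proof.
move=> [k [r E]]; exists (k + 5).+1.
by rewrite /= (run_add 5 E) !addnS /=; eexists.
Qed.

Lemma guard_returns1 {D P n y} : returns D n 1%N -> returns P n y ->
  returns (guard D P) n y.
Proof.
(* Beyond [D] and [P], one step enters the outer [Comp] and five go to [Proj 0], [Prec], [Zero], the
   inner [Comp] and [Proj 2]. The recursion step sees [[:: 0; 0; n]], so [Proj 2] recovers the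
   input. *)
move=> [k [r E]] [l [s F]]; exists (k + (l + 5)).+1.
rewrite /= (run_add _ E) addnC addnAC -addnA !addnS /=.
by rewrite (run_add _ F); eexists.
Qed.

Theorem theorem4 (R : realType) (P : prog)
    (P01 : zero_one_valued P) (P_not_extendable : ~ extendable P)
    (p q : rat) (pq : p < q) :
  ~ exists D : prog, forall n : nat,
      (returns D n 0%N /\ mean_a R P p n = mean_a R P q n) \/
      (returns D n 1%N /\ mean_a R P p n < mean_a R P q n).
Proof.
move=> [D HD]; apply: P_not_extendable.
have D0 n : returns D n 0%N -> forall k, ~~ finished P n k.
  move=> r0 k; apply/negP => Fk; have lt := mean_a_finished_lt R Fk pq.
  case: (HD n) => [[_ E]|[r1 _]]; first by rewrite E ltxx in lt.
  by have := returns_inj r0 r1.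
have D1 n : returns D n 1%N -> exists y, returns P n y.
  (* If [P] never halted on [n], both means would be 3, against the strict inequality certified by
     the answer 1. *)
  move=> r1; have [[k Fk]|NF] := pselect (exists k, finished P n k).
    exact: finished_returns Fk.
  case: (HD n) => [[r0 _]|[_]]; first by have := returns_inj r0 r1.
  by rewrite !mean_a_unfinished ?ltxx// => k;
    apply/negP => Fk; apply: NF; exists k.
have total n : exists y, returns (guard D P) n y /\ (y = 0%N \/ y = 1%N).
  case: (HD n) => [[r0 _]|[r1 _]].
    by exists 0%N; split; [exact: guard_returns0|left].
  have [y Py] := D1 n r1.
  by exists y; split; [exact: guard_returns1|exact: P01 Py].
(* [T] is only chosen classically, but [guard D P] returns its values, which makes it computable. *)
have [T HT] := choice total.
exists T; split=> [|n|n y Py].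
- by exists (guard D P) => n; case: (HT n).
- by case: (HT n).
have [Gn _] := HT n; case: (HD n) => [[r0 _]|[r1 _]].
  have [k Fk] := returns_finished Py.
  by have := D0 n r0 k; rewrite Fk.
exact: returns_inj Gn (guard_returns1 r1 Py).
Qed.
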